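(* Fix an input frame $\mathbf{S}=[\mathbf{s}_0,\ldots,\mathbf{s}_{M-1}]\in\mathbb{C}^{N\times M}$ and an arbitrary unitary matrix $\mathbf{U}\in\mathbb{C}^{N\times N}$. For $\chi\in\{\mathrm{P},\mathrm{A}\}$, let $\Gamma_{\chi}[k,q]$ be the self-ambiguity function of the conventional OFDM waveform $\mathbf{X}=\mathbf{F}_N^{H}\mathbf{S}$ and let $\bar\Gamma_{\chi}[k,q]$ be the self-ambiguity function of the DBU-OFDM waveform $\bar{\mathbf{X}}=\mathbf{F}_N^{H}\mathbf{U}\mathbf{S}$. Then the zero-delay Doppler cuts are identical under both correlation modes: $$\bar\Gamma_{\chi}[0,q]=\Gamma_{\chi}[0,q],\qquad q\in\mathbb{Z}_M^{\mathrm{c}},\quad \chi\in\{\mathrm{P},\mathrm{A}\}.$$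
   Context: Notation: $j=\sqrt{-1}$; for a positive integer $Q$, $\mathbb{Z}_Q=\{0,\ldots,Q-1\}$ and $a\bmod Q\in\mathbb{Z}_Q$ is the nonnegative remainder; $\mathbb{Z}_M^{\mathrm{c}}=\{-\lfloor M/2\rfloor,\ldots,\lceil M/2\rceil-1\}$. $N$ is the number of subcarriers and $M$ the number of OFDM symbols in a frame. $\mathbf{F}_N$ is the normalized DFT matrix, $[\mathbf{F}_N]_{a,b}=N^{-1/2}e^{-j2\pi ab/N}$ for $a,b\in\mathbb{Z}_N$. DBU-OFDM (deep block-unitary precoded OFDM) applies a frequency-domain unitary transformation $\mathbf{U}$, the same for all $M$ symbols, to the frame before the inverse DFT; conventional OFDM corresponds to $\mathbf{U}=\mathbf{I}_N$. For a time-domain waveform $\mathbf{X}\in\mathbb{C}^{N\times M}$ with entries $x_{n,m}$ ($n\in\mathbb{Z}_N$, $m\in\mathbb{Z}_M$), the per-symbol periodic ($\mathrm{P}$) and aperiodic ($\mathrm{A}$) autocorrelation functions are, for $k\in\mathbb{Z}_N$, $$r_{\mathrm{P},m}[k]=\sum_{n=0}^{N-1}x_{n,m}^{*}\,x_{(n+k)\bmod N,\,m},\qquad r_{\mathrm{A},m}[k]=\sum_{n=0}^{N-1-k}x_{n,m}^{*}\,x_{n+k,m},$$ and the self-ambiguity function of $\mathbf{X}$ in mode $\chi\in\{\mathrm{P},\mathrm{A}\}$ is $$\Gamma_{\chi}[k,q]=\sum_{m=0}^{M-1}r_{\chi,m}[k]\,e^{-j2\pi qm/M},\qquad (k,q)\in\mathbb{Z}_N\times\mathbb{Z}_M^{\mathrm{c}}.$$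 *)

(* Defs.v *)
From mathcomp Require Export all_boot all_order all_algebra.
From mathcomp Require Export complex reals trigo.

Set Implicit Arguments.
Unset Strict Implicit.
Unset Printing Implicit Defensive.

Import GRing.Theory Num.Theory.

Local Open Scope ring_scope.
Local Open Scope complex_scope.
Local Open Scope sesquilinear_scope.

Definition expj (R : realType) (t : R) : R[i] := cos t +i* sin t.

Definition dft (R : realType) (N : nat) : 'M[R[i]]_N :=
  \matrix_(a < N, b < N)
    (((Num.sqrt N%:R)^-1 : R)%:C
     * expj (- (2 * pi * a%:R * b%:R / N%:R))).

Lemma addmod_subproof (N : nat) (n k : 'I_N) : ((n + k) %% N < N)%N.
Proof. by rewrite ltn_pmod // (leq_ltn_trans _ (ltn_ord n)). Qed.

Definition addmod (N : nat) (n k : 'I_N) : 'I_N :=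
  Ordinal (addmod_subproof n k).

Lemma addtrunc_subproof (N : nat) (k : 'I_N) (n : 'I_(N - k)) : (n + k < N)%N.
Proof. by rewrite addnC -ltn_subRL. Qed.

Definition addtrunc (N : nat) (k : 'I_N) (n : 'I_(N - k)) : 'I_N :=
  Ordinal (addtrunc_subproof n).

Inductive corr_mode := Periodic | Aperiodic.

(* Conjugation is [Num.conj] on the closed field [R[i]], as in [^t*]. *)
Definition autocorr (R : realType) (N M : nat) (chi : corr_mode)
    (X : 'M[R[i]]_(N, M)) (m : 'I_M) (k : 'I_N) : R[i] :=
  match chi with
  | Periodic => \sum_(n < N) (Num.conj (X n m) * X (addmod n k) m)
  | Aperiodic =>
      \sum_(n < N - k)
        (Num.conj (X (widen_ord (leq_subr k N) n) m) * X (addtrunc n) m)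
  end.

(* {- floor(M/2), ..., ceil(M/2) - 1} *)
Definition centered_Z (M : nat) : {pred int} :=
  [pred q : int | - (M./2)%:Z <= q <= (uphalf M)%:Z - 1].

Definition self_ambiguity (R : realType) (N M : nat) (chi : corr_mode)
    (X : 'M[R[i]]_(N, M)) (k : 'I_N) (q : int) : R[i] :=
  \sum_(m < M)
    (autocorr chi X m k * expj (- (2 * pi * q%:~R * m%:R / M%:R))).

Definition ofdm (R : realType) (N M : nat) (S : 'M[R[i]]_(N, M)) :
    'M[R[i]]_(N, M) :=
  (dft R N)^t* *m S.

Definition dbu_ofdm (R : realType) (N M : nat) (U : 'M[R[i]]_N)
    (S : 'M[R[i]]_(N, M)) : 'M[R[i]]_(N, M) :=
  (dft R N)^t* *m U *m S.

(* Main.v *)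
Require Import Defs.
From mathcomp Require Import ring lra.

(** Both waveforms have the form [F^H V S] with [F^H V] having orthonormal
    columns, and at zero delay the correlation of either mode is the energy of
    the symbol, i.e. the diagonal entry [(X^H X) m m]; hence
    [X^H X = S^H V^H F F^H V S = S^H S] in both cases. *)

Import Order.TTheory GRing.Theory Num.Theory.

Local Open Scope ring_scope.
Local Open Scope complex_scope.
Local Open Scope sesquilinear_scope.

Lemma expjD (R : realType) (x y : R) : expj (x + y) = expj x * expj y.
Proof. by rewrite /expj cosD sinD [sin x * _ + _]addrC. Qed.

Lemma conj_expj (R : realType) (x : R) : Num.conj (expj x) = expj (- x).
Proof. by rewrite /expj cosN sinN. Qed.

Lemma expj0 (R : realType) : expj (0 : R) = 1.
Proof. by rewrite /expj cos0 sin0. Qed.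

Lemma expjX (R : realType) (x : R) n : expj x ^+ n = expj (x * n%:R).
Proof.
elim: n => [|n IHn]; first by rewrite mulr0 expj0.
by rewrite exprSr IHn -expjD -natr1 mulrDr mulr1.
Qed.

Lemma expj_2pi (R : realType) : expj (2 * pi : R) = 1.
Proof. by rewrite /expj mulr_natl cos2pi sin2pi. Qed.

(** Evenness of cosine allows passing to [|x|]. If [x] were nonzero, [|x| / 2] would lie strictly
    between 0 and [pi], where sine is positive, while cos |x| = 1 - 2 sin^2(|x| / 2) = 1 forces that
    sine to vanish. *)
Lemma expj_eq1 (R : realType) (x : R) :
  `|x| < 2 * pi -> expj x = 1 -> x = 0.
Proof.
move=> xlt ex1; apply/eqP; apply: contraT => x_neq0.
have cos1 : cos `|x| = 1.
  have /= <- := congr1 (@complex.Re R) ex1.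
  by case: (ler0P x) => _; rewrite ?cosN.
have /lt0r_neq0 : 0 < sin (`|x| / 2).
  by apply: sin_gt0_pi; rewrite divr_gt0 ?normr_gt0//= ltr_pdivrMr// mulrC.
have: cos ((`|x| / 2) *+ 2) = 1 by rewrite -mulr_natr divfK ?pnatr_eq0.
rewrite cos_mulr2n cos2sin2 -sqrf_eq0 => h.
suff -> : sin (`|x| / 2) ^+ 2 = 0 by rewrite eqxx.
by move: h; rewrite mulr2n; lra.
Qed.

(** Entry (a, b) of F F^H is 1/N times a geometric sum of ratio [expj x]. The ratio is 1 on the
    diagonal and an N-th root of unity other than 1 off it. *)
Lemma dft_unitary (R : realType) (N : nat) : dft R N \is unitarymx.
Proof.
apply/unitarymxP/matrixP => a b; rewrite !mxE.
(* The row index [a] witnesses that [N] is positive. *)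
have N_gt0 : (0 < N)%N by case: N a {b} => // -[].
have Nr_gt0 : 0 < N%:R :> R by rewrite ltr0n.
set x : R := 2 * pi * (b%:R - a%:R) / N%:R.
have term k : dft R N a k * (dft R N)^t* k b = (N%:R^-1 : R)%:C * expj x ^+ k.
  rewrite !mxE rmorphM/= conj_expj mulrACA -expjD expjX; congr (_ * expj _).
    have -> : Num.conj ((Num.sqrt N%:R)^-1 : R)%:C = ((Num.sqrt N%:R)^-1 : R)%:C.
      exact: conjc_real.
    by rewrite -rmorphM/= -invfM -expr2 sqr_sqrtr ?ler0n.
  by rewrite /x; field; rewrite gt_eqF.
rewrite (eq_bigr _ (fun k _ => term k)) -mulr_sumr.
have [ab|ab] := eqVneq a b.
  rewrite /x ab subrr mulr0 mul0r expj0.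
  rewrite (eq_bigr (fun=> 1)) => [|k _]; last by rewrite expr1n.
  rewrite sumr_const card_ord -(rmorph_nat (real_complex R)) -rmorphM/=.
  by rewrite mulVf ?gt_eqF.
(* Two indices below [N] differ by less than [N], which puts [x] in the range of [expj_eq1]. *)
have xlt : `|x| < 2 * pi.
  have pi2_gt0 : 0 < 2 * pi :> R by rewrite mulr_gt0 ?pi_gt0.
  rewrite /x -mulrA normrM gtr0_norm// -[ltRHS]mulr1 ltr_pM2l//.
  rewrite normrM normfV (gtr0_norm Nr_gt0) ltr_pdivrMr// mul1r.
  have: a%:R < N%:R :> R by rewrite ltr_nat.
  have: b%:R < N%:R :> R by rewrite ltr_nat.
  have := ler0n R a; have := ler0n R b.
  by rewrite ltr_norml => *; apply/andP; split; lra.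
have x_neq0 : x != 0.
  rewrite /x !mulf_eq0 invr_eq0 subr_eq0 !pnatr_eq0 eqr_nat (gtn_eqF N_gt0) orbF.
  by rewrite (gt_eqF (pi_gt0 R)) orbF/= eq_sym.
have ex_neq1 : expj x - 1 != 0.
  by rewrite subr_eq0; apply: contra_neq x_neq0; apply: expj_eq1.
have exN : expj x ^+ N = 1.
  rewrite expjX (_ : _ * _ = 2 * pi * b%:R - 2 * pi * a%:R); last first.
    by rewrite /x; field; rewrite gt_eqF.
  by rewrite expjD -conj_expj -!expjX expj_2pi !expr1n rmorph1 mulr1.
(* In z^N - 1 = (z - 1) * (geometric sum) with z = [expj x], the left side is 0 and z - 1 is not, so
   the sum vanishes. *)
have /eqP := subrX1 (expj x) N.
rewrite exN subrr eq_sym mulf_eq0 (negPf ex_neq1) /= => /eqP ->.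
by rewrite mulr0.
Qed.

Lemma autocorr0 (R : realType) (N M : nat) (hN : (0 < N)%N) (chi : corr_mode)
    (X : 'M[R[i]]_(N, M)) (m : 'I_M) :
  autocorr chi X m (Ordinal hN) = (X^t* *m X) m m.
Proof.
rewrite !mxE; case: chi => /=.
  apply: eq_bigr => n _; rewrite !mxE; congr (_ * X _ _).
  by apply: val_inj; rewrite /= addn0 modn_small.
(* The truncated sum runs over ['I_(N - 0)], not ['I_N] itself, so the full sum is transported along
   the cast. *)
rewrite [RHS](reindex (cast_ord (subn0 N))) /=; last first.
  by apply: onW_bij; exists (cast_ord (esym (subn0 N))) => n; apply: val_inj.
apply: eq_bigr => n _; rewrite !mxE.
by congr (Num.conj (X _ _) * X _ _); apply: val_inj; rewrite //= addn0.
Qed.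

Lemma gram_unitary_mul (C : numClosedFieldType) (N M : nat) (V : 'M[C]_N)
    (S : 'M[C]_(N, M)) :
  V \is unitarymx -> (V *m S)^t* *m (V *m S) = S^t* *m S.
Proof.
by move=> hV; rewrite trmx_mul map_mxM mulmxA mulmxKtV.
Qed.

Theorem lemma3 (R : realType) (N M : nat) (hN : (0 < N)%N) (hM : (0 < M)%N)
    (S : 'M[R[i]]_(N, M)) (U : 'M[R[i]]_N) (hU : U \is unitarymx)
    (chi : corr_mode) (q : int) (hq : q \in centered_Z M) :
  self_ambiguity chi (dbu_ofdm U S) (Ordinal hN) q
  = self_ambiguity chi (ofdm S) (Ordinal hN) q.
Proof.
have hF : (dft R N)^t* \is unitarymx by rewrite trmxC_unitary dft_unitary.
apply: eq_bigr => m _; rewrite !autocorr0 /dbu_ofdm /ofdm.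
(* The Gram identity is used with V = F^H U and with V = F^H; the former is unitary as a product of
   unitaries. *)
by rewrite !gram_unitary_mul// mul_unitarymx.
Qed.
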